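(* Let $\alpha\in(0,1)$, $E,A\in\mathbb{R}^{n\times n}$ with $\operatorname{rank}(E)=r<n$, $B\in\mathbb{R}^{n\times m}$, $C\in\mathbb{R}^{p\times n}$. Fix $E_1\in\mathbb{R}^{n\times(n-r)}$ with $\operatorname{rank}(E_1)=n-r$, $EE_1=0$, and $E_2\in\mathbb{R}^{(n-r)\times n}$ with $\operatorname{rank}(E_2)=n-r$, $E_2E=0$. Consider the system $E\mathscr{D}^\alpha x(t)=Ax(t)+Bu(t)$, $y(t)=Cx(t)$, with output feedback $u(t)=Fy(t)$, $F\in\mathbb{R}^{m\times p}$, so the closed-loop system is $E\mathscr{D}^\alpha x(t)=(A+BFC)x(t)$. Then this closed-loop system is admissible if and only if the following hold: there exist $X\in\mathbb{P}_\alpha^{n\times n}$, $Y\in\mathbb{R}^{(n-r)\times n}$, $Z\in\mathbb{R}^{m\times n}$ with $\mathrm{sym}(AXE^{\mathrm T}+AE_1Y+BZ)<0$, and, with $K_0=Z(XE^{\mathrm T}+E_1Y)^{-1}$, there exist $P\in\mathbb{P}_\alpha^{n\times n}$, $Q\in\mathbb{R}^{n\times(n-r)}$, $G\in\mathbb{R}^{m\times m}$, $H\in\mathbb{R}^{m\times p}$ such that $\begin{bmatrix}\Phi & (E^{\mathrm T}P+QE_2)B+C^{\mathrm T}H^{\mathrm T}-K_0^{\mathrm T}G^{\mathrm T}\\ * & -G-G^{\mathrm T}\end{bmatrix}<0$, where $\Phi=\mathrm{sym}\big(E^{\mathrm T}P(A+BK_0)+QE_2(A+BK_0)\big)$, and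 the controller gain is given by $F=G^{-1}H$.
   Context: $\mathscr{D}^\alpha$ denotes the Caputo fractional derivative of order $\alpha$. For a square matrix $M$, $\mathrm{sym}(M)=M^{\mathrm T}+M$; ''$<0$'' means negative definite; $*$ denotes the symmetric block, i.e. $\begin{bmatrix}A&B\\ *&C\end{bmatrix}=\begin{bmatrix}A&B\\ B^{\mathrm T}&C\end{bmatrix}$. For $\alpha\in(0,1)$, $\mathbb{P}_\alpha^{k\times k}=\{\sin(\tfrac{\alpha\pi}{2})X+\cos(\tfrac{\alpha\pi}{2})Y: X,Y\in\mathbb{R}^{k\times k},\ \begin{bmatrix}X&Y\\-Y&X\end{bmatrix}>0\}$ (positive definite). A system $\mathcal E\mathscr{D}^\alpha z=\mathcal A z$ is admissible if $\{\mathcal E,\mathcal A\}$ is regular ($\det(s\mathcal E-\mathcal A)\not\equiv0$), impulse free ($\deg\det(s\mathcal E-\mathcal A)=\operatorname{rank}\mathcal E$), and stable (all finite roots $\lambda$ of $\det(\lambda\mathcal E-\mathcal A)=0$ satisfy $|\arg\lambda|>\alpha\pi/2$). *)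

(* Defs.v *)
From HB Require Import structures.
From mathcomp Require Import all_boot all_order all_algebra.
From mathcomp Require Import reals trigo.
From mathcomp Require Import complex.
Set Implicit Arguments. Unset Strict Implicit. Unset Printing Implicit Defensive.
Import Order.TTheory GRing.Theory Num.Theory.
Local Open Scope ring_scope.

Definition symm (R : realType) (k : nat) (M : 'M[R]_k) : 'M[R]_k := M^T + M.

Definition posdef (R : realType) (k : nat) (M : 'M[R]_k) : Prop :=
  M^T = M /\ forall v : 'cV[R]_k, v != 0 -> 0 < (v^T *m M *m v) ord0 ord0.
Definition negdef (R : realType) (k : nat) (M : 'M[R]_k) : Prop := posdef (- M).

Definition Palpha (R : realType) (alpha : R) (k : nat) (M : 'M[R]_k) : Prop :=
  exists X Y : 'M[R]_k,
    posdef (block_mx X Y (- Y) X) /\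
    M = sin (alpha * pi / 2) *: X + cos (alpha * pi / 2) *: Y.

Definition pencil_det (R : realType) (k : nat) (E A : 'M[R]_k) : {poly R} :=
  \det ('X *: map_mx polyC E - map_mx polyC A).

Definition regular (R : realType) (k : nat) (E A : 'M[R]_k) : Prop :=
  pencil_det E A != 0.

Definition impulse_free (R : realType) (k : nat) (E A : 'M[R]_k) : Prop :=
  (size (pencil_det E A)).-1 = \rank E.

(* |arg lambda| > alpha pi / 2 ; arg lambda in (-pi, pi] is the principal argument,
   undefined for lambda = 0, which is therefore excluded (0 is not in the region). *)
Definition arg_gt (R : realType) (alpha : R) (lam : R[i]) : Prop :=
  lam != 0 /\
  forall rho theta : R, 0 < rho -> - pi < theta -> theta <= pi ->
    lam = Complex (rho * cos theta) (rho * sin theta) ->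
    alpha * pi / 2 < `|theta|.

Definition stable_frac (R : realType) (alpha : R) (k : nat) (E A : 'M[R]_k) : Prop :=
  forall lam : R[i],
    \det (lam *: map_mx (real_complex R) E - map_mx (real_complex R) A) = 0 ->
    arg_gt alpha lam.

Definition admissible (R : realType) (alpha : R) (k : nat) (E A : 'M[R]_k) : Prop :=
  regular E A /\ impulse_free E A /\ stable_frac alpha E A.

(* Main.v *)
(* The matrix E2 *m A *m E1 is invertible exactly when the pencil of (E, A) is
   regular and impulse free: up to a unit it is the determinant giving the
   coefficient of degree rank E in det (s E - A).  A kernel vector y of it makes
   the quadratic form of the LMI vanish at E1 y, and a finite root lam with
   kernel vector a + i b makes the form take on (E a, E b) a value that is
   negative only if |arg lam| > alpha pi / 2; so the LMI implies admissibility.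
   Conversely, an admissible pencil splits as diag(s - A1, - N) with N invertible.
   The region |arg lam| > alpha pi / 2 is the union of the two half-planes
   Re (rho lam) < 0 and Re (rho^* lam) < 0, where
   rho = sin (alpha pi / 2) + i cos (alpha pi / 2), and triangularization yields
   Hermitian H1, H2 > 0 for which rho H1 + rho^* H2 is a Lyapunov matrix of A1;
   its real part lies in P_alpha.
   In the theorem, the block LMI projects onto the LMI of the closed loop along
   the columns of col_mx 1 (F C - K0); conversely one takes K0 = F C, which
   reduces the off-diagonal block to (E^T P + Q E2) B, and G from a Schur
   complement. *)
Require Import Defs.
From HB Require Import structures.
From mathcomp Require Import all_boot all_order all_fingroup all_algebra.
From mathcomp Require Import reals trigo.
From mathcomp Require Import spectral complex ring lra.
Set Implicit Arguments. Unset Strict Implicit. Unset Printing Implicit Defensive.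
Import Order.TTheory GRing.Theory Num.Theory.
Local Open Scope ring_scope.

(* Conjugate transpose for an arbitrary conjugation [th]: complex conjugation
   gives Hermitian matrices, [idfun] real symmetric ones. *)
Definition hadj (K : numFieldType) (th : {rmorphism K -> K}) (m n : nat)
  (A : 'M[K]_(m, n)) : 'M[K]_(n, m) := map_mx th A^T.

Definition hpd (K : numFieldType) (th : {rmorphism K -> K}) (n : nat)
    (H : 'M[K]_n) : Prop :=
  hadj th H = H /\
  forall v : 'cV[K]_n, v != 0 -> 0 < (hadj th v *m H *m v) ord0 ord0.

(** * Adjoints and positive definite forms for a conjugation *)

Lemma hadjM (K : numFieldType) (th : {rmorphism K -> K}) (m n p : nat)
  (A : 'M[K]_(m, n)) (B : 'M[K]_(n, p)) :
  hadj th (A *m B) = hadj th B *m hadj th A.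
Proof. by rewrite /hadj trmx_mul map_mxM. Qed.

Lemma hadjK (K : numFieldType) (th : {rmorphism K -> K}) (m n : nat)
  (A : 'M[K]_(m, n)) : involutive th -> hadj th (hadj th A) = A.
Proof. by move=> thK; apply/matrixP=> i j; rewrite !mxE thK. Qed.

Lemma hadjD (K : numFieldType) (th : {rmorphism K -> K}) (m n : nat)
  (A B : 'M[K]_(m, n)) : hadj th (A + B) = hadj th A + hadj th B.
Proof. by rewrite /hadj linearD map_mxD. Qed.

Lemma hadjN (K : numFieldType) (th : {rmorphism K -> K}) (m n : nat)
  (A : 'M[K]_(m, n)) : hadj th (- A) = - hadj th A.
Proof. by rewrite /hadj linearN map_mxN. Qed.

Lemma hadj0 (K : numFieldType) (th : {rmorphism K -> K}) (m n : nat) :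
  hadj th (0 : 'M[K]_(m, n)) = 0.
Proof. by rewrite /hadj trmx0 map_mx0. Qed.

Lemma hadj1 (K : numFieldType) (th : {rmorphism K -> K}) (n : nat) :
  hadj th (1%:M : 'M[K]_n) = 1%:M.
Proof. by rewrite /hadj trmx1 map_mx1. Qed.

Lemma hadj_block (K : numFieldType) (th : {rmorphism K -> K}) (m1 m2 n1 n2 : nat)
  (A : 'M[K]_(m1, n1)) (B : 'M[K]_(m1, n2))
  (C : 'M[K]_(m2, n1)) (D : 'M[K]_(m2, n2)) :
  hadj th (block_mx A B C D)
  = block_mx (hadj th A) (hadj th C) (hadj th B) (hadj th D).
Proof. by rewrite /hadj tr_block_mx map_block_mx. Qed.

Lemma hpdD (K : numFieldType) (th : {rmorphism K -> K}) (n : nat)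
  (G H : 'M[K]_n) : hpd th G -> hpd th H -> hpd th (G + H).
Proof.
move=> [hG pG] [hH pH]; split=> [|v v0]; first by rewrite hadjD hG hH.
by rewrite mulmxDr mulmxDl mxE addr_gt0 ?pG ?pH.
Qed.

Lemma hpd_congr (K : numFieldType) (th : {rmorphism K -> K}) (n : nat)
  (S H : 'M[K]_n) : involutive th ->
  S \in unitmx -> hpd th H -> hpd th (hadj th S *m H *m S).
Proof.
move=> thK uS [hH pH]; split=> [|v v0]; first by rewrite !hadjM hadjK // hH mulmxA.
have Sv0 : S *m v != 0.
  by apply: contraNneq v0 => Sv0; rewrite -(mulKmx uS v) Sv0 mulmx0.
by have := pH _ Sv0; rewrite hadjM !mulmxA.
Qed.

Lemma hpd_diag (K : numFieldType) (th : {rmorphism K -> K}) (m n : nat)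
  (G : 'M[K]_m) (H : 'M[K]_n) :
  hpd th G -> hpd th H -> hpd th (block_mx G 0 0 H).
Proof.
move=> [hG pG] [hH pH]; split=> [|v v0].
  by rewrite hadj_block hG hH !hadj0.
rewrite -(vsubmxK v) in v0 *; set x := usubmx v; set y := dsubmx v.
have -> : hadj th (col_mx x y) *m block_mx G 0 0 H *m col_mx x y
    = hadj th x *m G *m x + hadj th y *m H *m y.
  rewrite /hadj tr_col_mx map_row_mx mul_row_block !mulmx0 addr0 add0r.
  by rewrite mul_row_col.
rewrite mxE; have [x0|/pG px] := eqVneq x 0; last first.
  apply: ltr_wpDr => //; have [->|/pH/ltW//] := eqVneq y 0.
  by rewrite mulmx0 mxE.
have /pH py : y != 0.
  by apply: contraNneq v0 => y0; rewrite -/x -/y x0 y0 col_mx0.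
by rewrite x0 mulmx0 mxE add0r.
Qed.

Lemma hpd_unit (K : numFieldType) (th : {rmorphism K -> K}) (n : nat)
  (H : 'M[K]_n) : hpd th H -> H \in unitmx.
Proof.
case=> _ pH; rewrite -unitmx_tr unitmxE unitfE; apply/negP => /det0P[v v0 vH].
have /pH : v^T != 0 by rewrite trmx_eq0.
have Hv : H *m v^T = 0 by apply: trmx_inj; rewrite trmx_mul trmxK vH trmx0.
by rewrite -mulmxA Hv mulmx0 mxE ltxx.
Qed.

Lemma hpd_inv_herm (K : numFieldType) (th : {rmorphism K -> K}) (n : nat)
  (H : 'M[K]_n) : hpd th H -> hadj th (invmx H) = invmx H.
Proof.
move=> hH; have uH := hpd_unit hH; rewrite -[LHS](mulmxK uH) -{2}(proj1 hH).
by rewrite -hadjM mulmxV // hadj1 mul1mx.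
Qed.

(** This is the congruence of [block_mx N 0 0 H] by the unipotent matrix [S], so an upper left block
    that exceeds the Schur correction by a positive [N] is enough for positivity. *)
Lemma hpd_schur (K : numFieldType) (th : {rmorphism K -> K}) (m n : nat)
  (N : 'M[K]_m) (g : 'M[K]_(n, m)) (H : 'M[K]_n) : involutive th ->
  hpd th N -> hpd th H ->
  hpd th (block_mx (N + hadj th g *m invmx H *m g) (hadj th g) g H).
Proof.
move=> thK hN hH; have uH := hpd_unit hH.
pose S : 'M[K]_(m + n) := block_mx 1%:M 0 (invmx H *m g) 1%:M.
have uS : S \in unitmx by rewrite unitmxE det_lblock !det1 mulr1 unitr1.
have := hpd_congr thK uS (hpd_diag hN hH).
congr hpd; rewrite hadj_block !hadj1 !hadj0 hadjM hpd_inv_herm //.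
rewrite !mulmx_block !(mulmx0, mul0mx, mulmx1, mul1mx, addr0, add0r).
by rewrite mulmxKV // mulKVmx // mulmxA.
Qed.

Lemma hpd_scalar1 (C : numClosedFieldType) (x : C) :
  0 < x -> hpd Num.conj (x%:M : 'M[C]_1).
Proof.
move=> x0; split=> [|v v0].
  rewrite /hadj tr_scalar_mx map_scalar_mx; congr (_%:M).
  by apply/CrealP; rewrite gtr0_real.
rewrite mul_mx_scalar -scalemxAl mxE mulr_gt0 // !mxE big_ord1 !mxE.
rewrite mulrC -normCK exprn_gt0 // normr_gt0; apply: contraNneq v0 => v00.
by apply/eqP; apply/matrixP=> i j; rewrite !ord1 v00 mxE.
Qed.

(** * Triangularization and a Lyapunov inequality over a closed field *)

(** A left eigenvector is completed to a basis, the rows of [S]. As it is a multiple of the first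
    row, the matrix in this basis has first row [(a, 0)]. This is one step of triangularization. *)
Lemma row_eigen_triangular (F : fieldType) (n : nat) (A : 'M[F]_n.+1) (a : F) :
  eigenvalue A a ->
  exists S : 'M[F]_(1 + n), exists b : 'cV[F]_n, exists A' : 'M[F]_n,
    S \in unitmx /\ S *m A = block_mx a%:M 0 b A' *m S.
Proof.
move=> /eigenvalueP[u uA u0].
pose S : 'M[F]_(1 + n) := row_ebase u.
have uS : S \in unitmx by apply: row_ebase_unit.
have ru : \rank u = 1%N by rewrite rank_rV u0.
pose e : 'rV[F]_(1 + n) := row_mx 1%:M 0.
have [c uE] : exists c, u = c *: (e *m S).
  exists (col_ebase u ord0 ord0).
  rewrite -[LHS]mulmx_ebase ru scalemxAl; congr (_ *m _).
  rewrite {1}[col_ebase u]mx11_scalar mul_scalar_mx; congr (_ *: _).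
  by apply/matrixP=> i j; rewrite !mxE ord1; case: splitP => k ->;
    rewrite ?ord1 !mxE //= ?andbT.
have c0 : c != 0 by apply: contraNneq u0 => c0; rewrite uE c0 scale0r.
have eA : e *m S *m A = a *: (e *m S).
  by apply: (scalerI c0); move: uA; rewrite uE -scalemxAl !scalerA [a * c]mulrC.
pose T : 'M[F]_(1 + n) := S *m A *m invmx S.
exists S, (dlsubmx T), (drsubmx T); split=> //.
have uT : usubmx T = row_mx a%:M 0.
  have -> : usubmx T = e *m T.
    by rewrite -[in RHS](vsubmxK T) mul_row_col mul1mx mul0mx addr0.
  rewrite /T !mulmxA eA -scalemxAl mulmxK // /e scale_row_mx scaler0.
  by rewrite scale_scalar_mx mulr1.
rewrite -[LHS](mulmxKV uS) -/T; congr (_ *m _).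
rewrite -[LHS]submxK /ulsubmx /ursubmx uT.
by rewrite row_mxKl row_mxKr.
Qed.

Lemma eigenvalue_lower_block (F : fieldType) (n : nat) (A S : 'M[F]_(1 + n))
    (a : F) (b : 'cV[F]_n) (A' : 'M[F]_n) (l : F) :
  S \in unitmx -> S *m A = block_mx a%:M 0 b A' *m S ->
  eigenvalue A' l -> l != a -> eigenvalue A l.
Proof.
move=> uS SA /eigenvalueP[w wA w0] la.
have la0 : l - a != 0 by rewrite subr_eq0.
pose x : 'rV[F]_(1 + n) := row_mx ((l - a)^-1 *: (w *m b)) w.
apply/eigenvalueP; exists (x *m S).
  rewrite -mulmxA SA mulmxA scalemxAl; congr (_ *m _).
  rewrite mul_row_block mulmx0 add0r wA scale_row_mx; congr row_mx.
  rewrite mul_mx_scalar !scalerA -{2}[w *m b]scale1r -scalerDl; congr (_ *: _).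
  by rewrite -[X in _ + X](mulfV la0) -mulrDl addrC subrK.
apply: contraNneq w0 => xS; have : x = 0 by rewrite -(mulmxK uS x) xS mul0mx.
by rewrite -row_mx0 => /eq_row_mx[_ ->].
Qed.

(** Induction on the size, splitting off one eigenvalue [a] at each step. Two matrices [H1] and [H2]
    are carried along so that each eigenvalue may weight the half-plane that contains it. *)
Lemma lyapunov_two_halfplanes (C : numClosedFieldType) (rho : C) (n : nat)
    (A : 'M[C]_n) :
  (forall l, eigenvalue A l -> 'Re (rho * l) < 0 \/ 'Re (rho^* * l) < 0) ->
  exists H1 : 'M[C]_n, exists H2 : 'M[C]_n,
    [/\ hpd Num.conj H1, hpd Num.conj H2 &
      let W := (rho *: H1 + rho^* *: H2) *m A in hpd Num.conj (- (W + hadj Num.conj W))].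
Proof.
have cK : involutive (Num.conj : C -> C) by exact: conjCK.
elim: n A => [|n IHn] A sA.
  have h0 : forall M : 'M[C]_0, hpd Num.conj M.
    by move=> M; rewrite [M]flatmx0; split=> [|v]; rewrite ?hadj0 // [v]flatmx0 eqxx.
  by exists 1%:M, 1%:M; split; [exact: h0 | exact: h0 | move=> W; exact: h0].
have [a ea] := eigenvalue_closed A (ltn0Sn n).
have [S [b [A' [uS SA]]]] := row_eigen_triangular ea.
have [l el|K1 [K2 [hK1 hK2 /= hQ]]] := IHn A'.
  have [->|la] := eqVneq l a; first exact: sA.
  exact/sA/(eigenvalue_lower_block uS SA el la).
set M' := rho *: K1 + rho^* *: K2 in hQ; set Q := - _ in hQ.
(* With x and y the two real parts and x < 0, the weights |y| + 1 on x and -x on y give x (|y| + 1 -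
   y) < 0. The other case is symmetric. *)
have [d1 [d2 [d10 d20 mu0]]] : exists d1, exists d2,
    [/\ 0 < d1, 0 < d2 & 'Re ((rho * d1 + rho^* * d2) * a) < 0].
  have reE : forall d1 d2, d1 \is Num.real -> d2 \is Num.real ->
    'Re ((rho * d1 + rho^* * d2) * a) = d1 * 'Re (rho * a) + d2 * 'Re (rho^* * a).
    move=> d1 d2 r1 r2; rewrite -!ReMl // -raddfD /=; congr ('Re _).
    by rewrite mulrDl; congr (_ + _); rewrite mulrAC mulrC.
  have rR := Creal_Re.
  have [s|s] := sA _ ea.
    exists (`|'Re (rho^* * a)| + 1), (- 'Re (rho * a)).
    rewrite oppr_gt0 s ltr_wpDl ?normr_ge0 ?ltr01 //; split=> //.
    rewrite reE ?rpredN ?rpredD ?normr_real ?rpred1 //.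
    rewrite mulNr [X in _ - X]mulrC -mulrBl nmulr_llt0 //.
    by rewrite addrAC ltr_wpDl ?ltr01 // subr_ge0 real_ler_norm.
  exists (- 'Re (rho^* * a)), (`|'Re (rho * a)| + 1).
  rewrite oppr_gt0 s ltr_wpDl ?normr_ge0 ?ltr01 //; split=> //.
  rewrite reE ?rpredN ?rpredD ?normr_real ?rpred1 //.
  rewrite addrC mulNr [X in _ - X]mulrC -mulrBl nmulr_llt0 //.
  by rewrite addrAC ltr_wpDl ?ltr01 // subr_ge0 real_ler_norm.
(* The scalar block is scaled by a large [t] so that its Schur complement with
   respect to [Q] is positive. *)
set mu := _ + _ in mu0.
pose p : C := - (mu * a + (mu * a)^*).
have p0 : 0 < p.
  rewrite oppr_gt0; move: mu0; rewrite ReE.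
  by rewrite pmulr_llt0 // invr_gt0 ltr0n.
pose g := - (M' *m b).
pose z := (hadj Num.conj g *m invmx Q *m g) ord0 ord0.
have zr : z \is Num.real.
  apply/CrealP; rewrite /z; set Z := _ *m g.
  have {2}<- : hadj Num.conj Z = Z by rewrite /Z !hadjM hadjK // hpd_inv_herm // mulmxA.
  by rewrite /hadj !mxE.
pose t := (`|z| + 1) / p.
have t0 : 0 < t by rewrite divr_gt0 // ltr_wpDl ?ltr01.
have hN : hpd Num.conj ((t * p - z)%:M : 'M[C]_1).
  apply: hpd_scalar1; rewrite /t divfK ?gt_eqF //.
  by rewrite addrAC ltr_wpDl ?ltr01 // subr_ge0 real_ler_norm.
have hD : forall d K, 0 < d -> hpd Num.conj K ->
    hpd Num.conj (block_mx (t * d)%:M 0 0 K : 'M[C]_(1 + n)).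
  by move=> d K d0 hK; apply: hpd_diag => //; apply: hpd_scalar1; rewrite mulr_gt0.
exists (hadj Num.conj S *m block_mx (t * d1)%:M 0 0 K1 *m S).
exists (hadj Num.conj S *m block_mx (t * d2)%:M 0 0 K2 *m S).
split; [exact/hpd_congr/hD | exact/hpd_congr/hD | move=> /=].
(* In the basis [S] the negated Lyapunov form has diagonal blocks [t * p] and [Q] and lower left
   block [g]. Writing [t * p] as [(t * p - z) + z], with [z] the Schur correction, puts it in the
   shape of [hpd_schur]. *)
have := hpd_congr cK uS (hpd_schur g cK hN hQ).
congr hpd.
pose D : 'M[C]_(1 + n) := block_mx (t * mu)%:M 0 0 M'.
have -> : (rho *: (hadj Num.conj S *m block_mx (t * d1)%:M 0 0 K1 *m S)
    + rho^* *: (hadj Num.conj S *m block_mx (t * d2)%:M 0 0 K2 *m S)) *m A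
    = hadj Num.conj S *m (D *m block_mx a%:M 0 b A') *m S.
  have -> : D = rho *: block_mx (t * d1)%:M 0 0 K1
              + rho^* *: block_mx (t * d2)%:M 0 0 K2.
    rewrite !scale_block_mx add_block_mx !scaler0 !addr0 /D; congr block_mx.
    rewrite !scale_scalar_mx -raddfD /=; congr (_%:M).
    by rewrite /mu mulrDr !(mulrCA _ t).
  rewrite -!mulmxA -SA !mulmxA; congr (_ *m _).
  by rewrite mulmxDr !mulmxDl -!scalemxAr -!scalemxAl.
set DT := D *m _.
rewrite [hadj _ (_ *m _ *m S)]hadjM [hadj _ (_ *m DT)]hadjM hadjK // mulmxA.
rewrite -mulmxDl -mulmxDr -mulNmx -mulmxN; congr (_ *m _ *m _).
rewrite /DT /D mulmx_block !(mulmx0, mul0mx, addr0, add0r) hadj_block !hadj0.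
rewrite add_block_mx opp_block_mx !(addr0, add0r); congr block_mx.
- rewrite -scalar_mxM [X in _ + X]mx11_scalar -/z -raddfD /= subrK.
  rewrite /hadj tr_scalar_mx map_scalar_mx -raddfD -raddfN /=; congr (_%:M).
  have tr : t^* = t by apply/CrealP; rewrite gtr0_real.
  by rewrite -[t * mu * a]mulrA [(t * _)^*]rmorphM /= tr -mulrDr -mulrN.
- by rewrite /g hadjN.
Qed.

(** * From Hermitian matrices to real symmetric ones *)

Lemma posdefE (R : realType) (k : nat) (M : 'M[R]_k) :
  posdef M <-> hpd idfun M.
Proof.
have adjE : forall m n (A : 'M[R]_(m, n)), hadj idfun A = A^T.
  by move=> m n A; rewrite /hadj map_mx_id.
rewrite /hpd adjE; split=> -[hM pM]; split=> // v v0.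
  by rewrite adjE; apply: pM.
by have := pM v v0; rewrite adjE.
Qed.

Lemma map_Re_mulmx (R : realType) (m n p : nat)
    (A : 'M[R[i]]_(m, n)) (B : 'M[R[i]]_(n, p)) :
  map_mx (@complex.Re R) (A *m B)
  = map_mx (@complex.Re R) A *m map_mx (@complex.Re R) B
    - map_mx (@complex.Im R) A *m map_mx (@complex.Im R) B.
Proof.
apply/matrixP=> i j; rewrite !mxE (raddf_sum (@complex.Re R : Rcomplex R -> R)).
rewrite -sumrB; apply: eq_bigr => k _; rewrite !mxE.
by case: (A i k) (B k j) => [a b] [c d].
Qed.

Lemma map_Im_mulmx (R : realType) (m n p : nat)
    (A : 'M[R[i]]_(m, n)) (B : 'M[R[i]]_(n, p)) :
  map_mx (@complex.Im R) (A *m B)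
  = map_mx (@complex.Re R) A *m map_mx (@complex.Im R) B
    + map_mx (@complex.Im R) A *m map_mx (@complex.Re R) B.
Proof.
apply/matrixP=> i j; rewrite !mxE (raddf_sum (@complex.Im R : Rcomplex R -> R)).
rewrite -big_split; apply: eq_bigr => k _; rewrite !mxE.
by case: (A i k) (B k j) => [a b] [c d].
Qed.

Lemma map_Re_hadj (R : realType) (m n : nat) (A : 'M[R[i]]_(m, n)) :
  map_mx (@complex.Re R) (hadj Num.conj A) = (map_mx (@complex.Re R) A)^T.
Proof. by apply/matrixP=> i j; rewrite !mxE; case: (A j i). Qed.

Lemma map_Im_hadj (R : realType) (m n : nat) (A : 'M[R[i]]_(m, n)) :
  map_mx (@complex.Im R) (hadj Num.conj A) = - (map_mx (@complex.Im R) A)^T.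
Proof. by apply/matrixP=> i j; rewrite !mxE; case: (A j i). Qed.

(** The real form at [col_mx a b] is the Hermitian form at a + i b. *)
Lemma posdef_realification (R : realType) (n : nat) (H : 'M[R[i]]_n) :
  hpd Num.conj H ->
  posdef (block_mx (map_mx (@complex.Re R) H) (- map_mx (@complex.Im R) H)
                   (map_mx (@complex.Im R) H) (map_mx (@complex.Re R) H)).
Proof.
move=> [hH pH]; set X := map_mx _ H; set Y := map_mx (@complex.Im R) H.
have XT : X^T = X by rewrite -map_Re_hadj hH.
have YT : Y^T = - Y by apply: (canRL (@opprK _)); rewrite -map_Im_hadj hH.
split=> [|v v0]; first by rewrite tr_block_mx XT linearN /= YT opprK.
rewrite -(vsubmxK v) in v0 *; set a := usubmx v; set b := dsubmx v.
pose w : 'cV[R[i]]_n := \matrix_(i, j) Complex (a i j) (b i j).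
have wa : map_mx (@complex.Re R) w = a by apply/matrixP=> i j; rewrite !mxE.
have wb : map_mx (@complex.Im R) w = b by apply/matrixP=> i j; rewrite !mxE.
have w0 : w != 0.
  apply: contraNneq v0 => w0; rewrite -/a -/b -wa -wb w0.
  by rewrite !map_mx0 ?raddf0 // col_mx0.
have := pH w w0; rewrite ltcE => /andP[_].
suff -> : complex.Re ((hadj Num.conj w *m H *m w) ord0 ord0)
    = ((col_mx a b)^T *m block_mx X (- Y) Y X *m col_mx a b) ord0 ord0 by [].
have -> : complex.Re ((hadj Num.conj w *m H *m w) ord0 ord0)
  = (map_mx (@complex.Re R) (hadj Num.conj w *m H *m w)) ord0 ord0 by rewrite [RHS]mxE.
congr (_ ord0 ord0).
rewrite !(map_Re_mulmx, map_Im_mulmx, map_Re_hadj, map_Im_hadj) wa wb -/X -/Y.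
rewrite tr_col_mx mul_row_block mul_row_col.
by rewrite !(mulmxBl, mulmxDl, mulNmx, mulmxN, opprK, opprD, opprB) addrA.
Qed.

(** Congruence by diag(1, -1), the real counterpart of replacing a Hermitian matrix by its complex
    conjugate. *)
Lemma posdef_block_flip (R : realType) (n : nat) (X Y : 'M[R]_n) :
  posdef (block_mx X Y (- Y) X) -> posdef (block_mx X (- Y) Y X).
Proof.
rewrite !posdefE => hp.
pose S : 'M[R]_(n + n) := block_mx 1%:M 0 0 (- 1%:M).
have uS : S \in unitmx.
  by rewrite unitmxE det_lblock det1 mul1r -scaleN1r detZ det1 mulr1 unitrX ?unitrN1.
have := hpd_congr (th := idfun) (fun _ => erefl) uS hp; congr hpd.
rewrite hadj_block !hadj0 hadjN !hadj1 !mulmx_block.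
by rewrite !(mulmx0, mul0mx, mulmx1, mul1mx, addr0, add0r, mulmxN, mulNmx, opprK).
Qed.

Lemma posdef_ul (R : realType) (m n : nat) (X : 'M[R]_m) (Y : 'M[R]_(m, n))
    (Z : 'M[R]_(n, m)) (T : 'M[R]_n) :
  posdef (block_mx X Y Z T) -> posdef X.
Proof.
move=> [hM pM]; split=> [|v v0].
  by move: hM; rewrite tr_block_mx => /eq_block_mx[].
have /pM : col_mx v 0 != 0 :> 'cV[R]_(m + n).
  by apply: contraNneq v0; rewrite -col_mx0 => /eq_col_mx[-> _].
by rewrite tr_col_mx mul_row_block mul_row_col trmx0 !mul0mx !mulmx0 !addr0.
Qed.

(** * The stability region in Cartesian coordinates *)

Lemma cos_sin_gt0 (R : realType) (alpha : R) : 0 < alpha < 1 ->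
  0 < sin (alpha * pi / 2) /\ 0 < cos (alpha * pi / 2).
Proof.
move=> /andP[a0 a1]; have p0 := pi_gt0 R.
have ? : 0 < alpha * pi by rewrite mulr_gt0.
have ? : alpha * pi < pi by rewrite gtr_pMl.
by split; [apply: sin_gt0_pihalf | apply: cos_gt0_pihalf]; apply/andP; split; lra.
Qed.

(** The negated inequality describes the closed sector of half-angle [t] around the positive real
    axis, including 0. The argument of a nonzero point of modulus [rho] in that sector is
    [acos (a / rho)] up to the sign of [b]. *)
Lemma arg_gtP (R : realType) (alpha a b : R) : 0 < alpha < 1 ->
  arg_gt alpha (Complex a b) <->
  sin (alpha * pi / 2) * a < cos (alpha * pi / 2) * `|b|.
Proof.
move=> al; have [s0 c0] := cos_sin_gt0 al.
have /andP[al0 al1] := al; have p0 := pi_gt0 R.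
have t0 : 0 < alpha * pi by rewrite mulr_gt0.
have t1 : alpha * pi < pi by rewrite gtr_pMl.
have cs := cos2Dsin2 (alpha * pi / 2).
set t := alpha * pi / 2 in s0 c0 cs *.
have tI : t \in `[0, pi]%R by rewrite in_itv /=; apply/andP; split; rewrite /t; lra.
have tpi : t < pi by rewrite /t; lra.
have t_gt0 : 0 < t by rewrite /t; lra.
set s := sin t in s0 cs *; set c := cos t in c0 cs *.
split=> [[lam0 polar]|sc].
  rewrite ltNge; apply/negP => cs_le.
  have a0 : 0 <= a.
    rewrite -(pmulr_rge0 _ s0); apply: le_trans cs_le.
    by rewrite mulr_ge0 ?normr_ge0 ?(ltW c0).
  have q0 : 0 < a ^+ 2 + b ^+ 2.
    rewrite lt0r paddr_eq0 ?sqr_ge0 // !sqrf_eq0 addr_ge0 ?sqr_ge0 // andbT.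
    by apply: contraNN lam0; rewrite eq_complex.
  pose rho := Num.sqrt (a ^+ 2 + b ^+ 2).
  have rho0 : 0 < rho by rewrite sqrtr_gt0.
  have rho2 : rho ^+ 2 = a ^+ 2 + b ^+ 2 by rewrite sqr_sqrtr // (ltW q0).
  have ar : a <= rho by rewrite -ler_sqr ?nnegrE ?a0 ?(ltW rho0) // rho2 lerDl sqr_ge0.
  (* Squaring c |b| <= s a and using s^2 + c^2 = 1 gives c^2 (a^2 + b^2) <= a^2. *)
  have cr : c * rho <= a.
    rewrite -ler_sqr ?nnegrE ?mulr_ge0 ?a0 ?(ltW c0) ?(ltW rho0) //.
    have sc2 : (c * `|b|) ^+ 2 <= (s * a) ^+ 2.
      by rewrite ler_sqr ?nnegrE ?mulr_ge0 ?normr_ge0 ?(ltW c0) ?(ltW s0).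
    move: sc2; rewrite !exprMn rho2 real_normK ?num_real //.
    move: cs; set c2 := c ^+ 2; set s2 := s ^+ 2; set a2 := a ^+ 2; set b2 := b ^+ 2.
    by move=> cs; have -> : s2 = 1 - c2; [lra | nra].
  pose u := a / rho.
  have cu : c <= u by rewrite /u ler_pdivlMr.
  have u1 : u <= 1 by rewrite /u ler_pdivrMr ?mul1r.
  have uI : -1 <= u <= 1 by apply/andP; split; lra.
  have acosu : acos u <= t.
    rewrite leNgt; apply/negP => tu.
    have : cos (acos u) < cos t.
      by rewrite ltr_cos // in_itv /= acos_ge0 // acos_lepi.
    by rewrite acosK ?in_itv //= ltNge cu.
  have acos0 : 0 <= acos u by exact: acos_ge0.
  have sinu : rho * sin (acos u) = `|b|.
    rewrite sin_acos // -[rho in LHS]ger0_norm ?ltW // -sqrtr_sqr -sqrtrM ?sqr_ge0 //.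
    rewrite mulrBr mulr1 -exprMn /u mulrC divfK ?gt_eqF // rho2 addrC addKr.
    by rewrite sqrtr_sqr.
  have au : a = rho * cos (acos u) by rewrite acosK ?in_itv //= /u mulrC divfK ?gt_eqF.
  (* The polar hypothesis is applied to the angle [acos u] or [- acos u] according to the sign of
     [b]. Both contradict [acosu]. *)
  have [b0|b0] := leP 0 b.
    have := polar rho (acos u) rho0; rewrite ger0_norm //.
    rewrite sinu -au ger0_norm // -/t => h.
    have : t < acos u by apply: h => //; [lra | exact: acos_lepi].
    by rewrite ltNge acosu.
  have := polar rho (- acos u) rho0; rewrite normrN (ger0_norm acos0) cosN sinN.
  rewrite mulrN sinu -au ltr0_norm // opprK -/t => h.
  have : t < acos u by apply: h => //; lra.
  by rewrite ltNge acosu.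
split=> [|rho th rho0 th0 th1 [aE bE]].
  apply/eqP => -[a0 b0]; move: sc; rewrite a0 b0 normr0 !mulr0; lra.
(* An angle of modulus at most [t] has cosine at least [c] and sine of modulus at most [s];
   multiplying the two bounds contradicts [sc]. *)
rewrite ltNge; apply/negP => th_t.
have cth : c <= cos `|th|.
  rewrite leNgt; apply/negP; rewrite ltr_cos //; first by rewrite ltNge th_t.
  by rewrite in_itv /= normr_ge0 ler_norml ltW.
have csth : cos `|th| = cos th by case: (ger0P th) => _; rewrite ?cosN.
have sth : `|sin th| <= s.
  rewrite -ler_sqr ?nnegrE ?(ltW s0) // real_normK ?num_real //.
  have := cos2Dsin2 th; rewrite -csth.
  have : c ^+ 2 <= cos `|th| ^+ 2 by rewrite ler_sqr ?nnegrE ?(ltW c0) //; lra.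
  lra.
move: sc; rewrite ltNge aE bE normrM gtr0_norm // !(mulrCA _ rho) ler_pM2l //.
by rewrite -csth [s * _]mulrC ler_pM ?normr_ge0 ?(ltW c0).
Qed.

(** * The set [Palpha] and its Lyapunov inequality *)

(** Used to exchange the two vectors of a bilinear form by transposing its value. *)
Lemma trmx11 (R : realType) (M : 'M[R]_1) : M^T = M.
Proof. by apply/matrixP=> i j; rewrite !mxE !ord1. Qed.

(** Symmetry of the block matrix makes [Y] skew, so the two cross terms coincide and give the
    doubled term. *)
Lemma posdef_skewP (R : realType) (n : nat) (X Y : 'M[R]_n) :
  posdef (block_mx X Y (- Y) X) <->
  [/\ X^T = X, Y^T = - Y & forall a b : 'cV[R]_n, (a != 0) || (b != 0) ->
    0 < (a^T *m X *m a + b^T *m X *m b + (a^T *m Y *m b) *+ 2) ord0 ord0].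
Proof.
have skewE : Y^T = - Y -> forall a b : 'cV[R]_n,
    (col_mx a b)^T *m block_mx X Y (- Y) X *m col_mx a b
    = a^T *m X *m a + b^T *m X *m b + (a^T *m Y *m b) *+ 2.
  move=> YT a b; rewrite tr_col_mx mul_row_block mul_row_col !mulmxDl.
  rewrite -[b^T *m - Y *m a]trmx11 !trmx_mul linearN /= YT opprK trmxK.
  by rewrite mulmxA mulr2n -!addrA; congr (_ + _); rewrite [LHS]addrA addrC.
split=> [[hM pM]|[XT YT pXY]].
  move: (hM); rewrite tr_block_mx => /eq_block_mx[XT _ YT _].
  split=> // a b ab; rewrite -skewE //; apply: pM.
  by apply: contraTneq ab; rewrite -col_mx0 => /eq_col_mx[-> ->]; rewrite eqxx.
split=> [|v v0]; first by rewrite tr_block_mx XT linearN /= YT opprK.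
rewrite -(vsubmxK v) skewE //; apply: pXY.
apply: contraNT v0; rewrite negb_or !negbK => /andP[/eqP a0 /eqP b0].
by rewrite -(vsubmxK v) a0 b0 col_mx0.
Qed.

(** Transposition fixes [X] and negates the skew part [Y], which is the block flip. *)
Lemma Palpha_tr (R : realType) (alpha : R) (n : nat) (P : 'M[R]_n) :
  Palpha alpha P -> Palpha alpha P^T.
Proof.
move=> [X [Y [hXY ->]]]; exists X, (- Y); rewrite opprK.
split; first exact: posdef_block_flip.
have [XT YT _] := (posdef_skewP X Y).1 hXY.
by rewrite linearD !linearZ /= XT YT.
Qed.

Lemma Re_complexE (R : realType) (z : R[i]) : 'Re z = (complex.Re z)%:C%C.
Proof. by rewrite ReE ReJ_add. Qed.

(** With rho = s + i c, the real parts of rho (a + i b) and rho^* (a + i b) are s a - c b and s a +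
    c b, so the sector condition is that one of them is negative. As [A] is real, the real part of
    the complex Lyapunov inequality is again one for [A]. *)
Lemma Palpha_lyapunov (R : realType) (alpha : R) (n : nat) (A : 'M[R]_n) :
  0 < alpha < 1 ->
  (forall lam, \det (lam%:M - map_mx (real_complex R) A) = 0 -> arg_gt alpha lam) ->
  exists P : 'M[R]_n, Palpha alpha P /\ negdef (symm (P *m A)).
Proof.
move=> al stA; set s := sin (alpha * pi / 2); set c := cos (alpha * pi / 2).
have [s0 c0] := cos_sin_gt0 al.
have [l el|H1 [H2 [hH1 hH2 /= hW]]] :=
    @lyapunov_two_halfplanes _ (Complex s c) n (map_mx (real_complex R) A).
  have /stA : \det (l%:M - map_mx (real_complex R) A) = 0.
    have /eigenvalueP[v vA v0] := el; apply/eqP/det0P; exists v => //.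
    by rewrite mulmxBr vA mul_mx_scalar subrr.
  case: l {el} => a b /(arg_gtP _ _ al) ab.
  have [b0|b0] := leP 0 b; [left | right];
    rewrite Re_complexE -(rmorph0 (real_complex R)) ltcR /=.
    by rewrite subr_lt0; rewrite ger0_norm in ab.
  by move: ab; rewrite ltr0_norm // mulNr opprK mulrN -/s -/c => ab; rewrite -ltrBrDr sub0r.
have p1 := posdef_realification hH1.
have := posdef_realification hH2; rewrite -[X in block_mx _ _ X _]opprK.
move=> /posdef_block_flip; rewrite opprK => p2.
have := posdef_ul (posdef_realification hW).
set X1 := map_mx (@complex.Re R) H1 in p1 *; set X2 := map_mx (@complex.Re R) H2 in p2 *.
set Y1 := map_mx (@complex.Im R) H1 in p1 *; set Y2 := map_mx (@complex.Im R) H2 in p2 *.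
(* The witness is the real part of rho H1 + rho^* H2. Its block matrix is the realification of [H1]
   plus the flipped one of [H2]. *)
move=> pW; exists (s *: (X1 + X2) + c *: (Y2 - Y1)); split.
  exists (X1 + X2), (Y2 - Y1); split=> //.
  have -> : block_mx (X1 + X2) (Y2 - Y1) (- (Y2 - Y1)) (X1 + X2)
    = block_mx X1 (- Y1) Y1 X1 + block_mx X2 Y2 (- Y2) X2.
    by rewrite add_block_mx opprB [Y2 - Y1]addrC.
  by apply/posdefE/hpdD; apply/posdefE.
move: pW; rewrite /negdef /symm; congr posdef.
set M := _ *m map_mx _ A.
have ReM : map_mx (@complex.Re R) M = (s *: (X1 + X2) + c *: (Y2 - Y1)) *m A.
  rewrite map_Re_mulmx.
  have -> : map_mx (@complex.Im R) (map_mx (real_complex R) A) = 0.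
    by apply/matrixP=> i j; rewrite !mxE.
  have -> : map_mx (@complex.Re R) (map_mx (real_complex R) A) = A.
    by apply/matrixP=> i j; rewrite !mxE.
  rewrite mulmx0 subr0; congr (_ *m _); apply/matrixP=> i j; rewrite !mxE.
  by case: (H1 i j) (H2 i j) => [a b] [a' b'] /=; ring.
rewrite -ReM -map_Re_hadj addrC; move: M {ReM} => M.
by apply/matrixP=> i j; rewrite !mxE; case: (M i j) (M j i) => [a b] [a' b'].
Qed.

(** * Stability from the LMI *)

Lemma stable_of_lmi (R : realType) (alpha : R) (n k : nat) (E A P : 'M[R]_n)
    (E2 : 'M[R]_(k, n)) (Q : 'M[R]_(n, k)) :
  0 < alpha < 1 -> E2 *m E = 0 -> Palpha alpha P ->
  negdef (symm (E^T *m P *m A + Q *m E2 *m A)) -> stable_frac alpha E A.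
Proof.
move=> al E2E [X [Y [/posdef_skewP[XT YT pXY] PE]]] [_ pS] [l1 l2].
have [s0 c0] := cos_sin_gt0 al.
rewrite -det_tr => /eqP/det0P[v v0 vM].
have {vM} Mw : (Complex l1 l2 *: map_mx (real_complex R) E
    - map_mx (real_complex R) A) *m v^T = 0.
  by apply: trmx_inj; rewrite trmx_mul trmxK vM trmx0.
pose a := map_mx (@complex.Re R) v^T; pose b := map_mx (@complex.Im R) v^T.
have ab0 : (a != 0) || (b != 0).
  apply: contraNT v0; rewrite negb_or !negbK => /andP[/eqP a0 /eqP b0].
  apply/eqP; apply/matrixP=> i j; move/matrixP: a0 => /(_ j i).
  by move/matrixP: b0 => /(_ j i); rewrite !mxE; case: (v i j) => x y /= -> ->.
pose N1 : 'M[R]_n := l1 *: E - A; pose N2 : 'M[R]_n := l2 *: E.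
have [ReN ImN] : map_mx (@complex.Re R) (Complex l1 l2 *: map_mx (real_complex R) E
     - map_mx (real_complex R) A) = N1 /\
   map_mx (@complex.Im R) (Complex l1 l2 *: map_mx (real_complex R) E
     - map_mx (real_complex R) A) = N2.
  by split; apply/matrixP=> i j; rewrite !mxE /=; ring.
have Aa : A *m a = l1 *: (E *m a) - l2 *: (E *m b).
  have := congr1 (map_mx (@complex.Re R)) Mw.
  rewrite map_Re_mulmx ReN ImN -/a -/b map_mx0 ?raddf0 // mulmxBl -!scalemxAl.
  by move/eqP; rewrite addrAC subr_eq0 => /eqP.
have Ab : A *m b = l1 *: (E *m b) + l2 *: (E *m a).
  have := congr1 (map_mx (@complex.Im R)) Mw.
  rewrite map_Im_mulmx ReN ImN -/a -/b map_mx0 ?raddf0 // mulmxBl -!scalemxAl.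
  by move/eqP; rewrite addrAC subr_eq0 => /eqP.
set W := _ + _ in pS.
have symmE : forall u : 'cV[R]_n,
    (u^T *m - symm W *m u) ord0 ord0 = - (u^T *m (W *m u)) ord0 ord0 *+ 2.
  move=> u; rewrite mulmxN mulNmx /symm mulmxDr mulmxDl.
  rewrite -[u^T *m W^T *m u]trmx11 !trmx_mul !trmxK mulmxA.
  by rewrite mxE [in LHS]mxE mulr2n opprD.
pose q M (u w : 'cV[R]_n) := (u^T *m M *m w) ord0 ord0.
pose a' := E *m a; pose b' := E *m b.
(* On the range of [E] the term in [Q] disappears, because [E2 *m E = 0]. By [Aa] and [Ab], both
   [A *m a] and [A *m b] lie in that range. *)
have WE : forall u w : 'cV[R]_n, u^T *m (E^T *m P + Q *m E2) *m (E *m w)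
    = (E *m u)^T *m P *m (E *m w).
  move=> u w; rewrite mulmxDr mulmxDl trmx_mul -!mulmxA.
  by rewrite [E2 *m (E *m w)]mulmxA E2E mul0mx !mulmx0 addr0.
have WA : forall u : 'cV[R]_n, u^T *m (W *m u)
    = u^T *m (E^T *m P + Q *m E2) *m (A *m u).
  by move=> u; rewrite /W -mulmxDl !mulmxA.
have linE : forall (x y : R) (M N : 'M[R]_1),
    (x *: M + y *: N) ord0 ord0 = x * M ord0 ord0 + y * N ord0 ord0.
  by move=> x y M N; rewrite !mxE.
have aWa : (a^T *m (W *m a)) ord0 ord0 = l1 * q P a' a' - l2 * q P a' b'.
  by rewrite WA Aa mulmxBr -!scalemxAr !WE -scaleNr linE mulNr.
have bWb : (b^T *m (W *m b)) ord0 ord0 = l1 * q P b' b' + l2 * q P b' a'.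
  by rewrite WA Ab (mulmxDr _ (l1 *: _)) -!scalemxAr !WE linE.
have qP : forall u w, q P u w = sin (alpha * pi / 2) * q X u w
    + cos (alpha * pi / 2) * q Y u w.
  by move=> u w; rewrite /q PE mulmxDr mulmxDl -!scalemxAr -!scalemxAl linE.
have qX : forall u w, q X u w = q X w u.
  by move=> u w; rewrite /q -[u^T *m X *m w]trmx11 !trmx_mul trmxK XT mulmxA.
have qY : forall u w, q Y u w = - q Y w u.
  move=> u w; rewrite /q -[u^T *m Y *m w]trmx11 !trmx_mul trmxK YT mulmxA.
  by rewrite mulmxN mulNmx mxE.
have lt0 : (a^T *m (W *m a)) ord0 ord0 + (b^T *m (W *m b)) ord0 ord0 < 0.
  have pS' : forall u : 'cV[R]_n, u != 0 -> (u^T *m (W *m u)) ord0 ord0 < 0.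
    by move=> u /pS; rewrite symmE; lra.
  have [a0|/pS' pa] := eqVneq a 0.
    by move: ab0; rewrite a0 eqxx /= => /pS'; rewrite trmx0 mul0mx [X in X + _]mxE add0r.
  have [->|/pS' pb] := eqVneq b 0; first by rewrite trmx0 mul0mx [X in _ + X]mxE addr0.
  by rewrite -oppr_gt0 opprD addr_gt0 ?oppr_gt0.
(* If [E a] and [E b] both vanish, then so does the sum in [lt0], a contradiction. *)
have [ab'0|ab'0] := boolP ((a' != 0) || (b' != 0)); last first.
  move: ab'0 lt0; rewrite negb_or !negbK => /andP[/eqP a'0 /eqP b'0].
  rewrite aWa bWb a'0 b'0 /q trmx0 !mul0mx mxE; lra.
have p1 := pXY a' b' ab'0.
have sumE : forall M N L : 'M[R]_1, (M + N + L *+ 2) ord0 ord0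
    = M ord0 ord0 + N ord0 ord0 + L ord0 ord0 *+ 2.
  by move=> M N L; rewrite !mulr2n !mxE.
(* Exchanging the two vectors reverses the sign of the skew term, so [p1] and [p2] together bound
   |2y| by x1 + x2. *)
have p2 : 0 < q X b' b' + q X a' a' + q Y b' a' *+ 2.
  by have := pXY b' a'; rewrite orbC => /(_ ab'0); rewrite sumE.
have {}p1 : 0 < q X a' a' + q X b' b' + q Y a' b' *+ 2.
  by move: p1; rewrite sumE.
have ya : q Y a' a' = 0 by have := qY a' a'; lra.
have yb : q Y b' b' = 0 by have := qY b' b'; lra.
move: lt0; rewrite aWa bWb !qP ya yb [q X b' a']qX; rewrite [q Y b' a']qY in p2 *.
move: p1 p2; set x1 := q X a' a'; set x2 := q X b' b'; set y := q Y a' b'.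
set z := q X a' b' => p1 p2 lt0; apply/(arg_gtP _ _ al).
set s := sin _ in s0 lt0 *; set c := cos _ in c0 lt0 *.
have x0 : 0 < x1 + x2 by lra.
(* In the sum the terms in [z] cancel, so [lt0] reads s l1 (x1 + x2) < 2 c l2 y. The bound on |2y|
   then yields the claim multiplied by x1 + x2. *)
rewrite -(ltr_pM2r x0); apply: (@lt_le_trans _ _ (c * (l2 * (y *+ 2)))).
  by move: lt0; rewrite -subr_lt0 => lt0; rewrite -subr_lt0; congr (_ < 0): lt0; ring.
rewrite -mulrA ler_pM2l //; apply: le_trans (ler_norm _) _.
rewrite normrM ler_wpM2l ?normr_ge0 // ler_norml; apply/andP; split; lra.
Qed.

(** * Top coefficient of the pencil determinant *)

Lemma coefM_top (R : comNzRingType) (p q : {poly R}) (m n : nat) :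
  (size p <= m.+1)%N -> (size q <= n.+1)%N -> (p * q)`_(m + n) = p`_m * q`_n.
Proof.
move=> sp sq; rewrite coefM.
have mP : (m < (m + n).+1)%N by rewrite ltnS leq_addr.
rewrite (bigD1 (Ordinal mP)) //= addKn big1 ?addr0 // => j jm.
have [jm'|mj] := ltnP m j; first by rewrite (leq_sizeP _ _ sp) ?mul0r.
rewrite (leq_sizeP _ _ sq) ?mulr0 // ltn_subRL ltn_add2r ltn_neqAle mj andbT.
by [].
Qed.

Lemma prod_top (R : comNzRingType) (I : finType) (F : I -> {poly R}) (d : I -> nat) :
  (forall i, (size (F i) <= (d i).+1)%N) ->
  (size (\prod_i F i)%R <= (\sum_i d i).+1)%N /\
  (\prod_i F i)`_(\sum_i d i) = \prod_i (F i)`_(d i).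
Proof.
move=> sF; apply: (big_rec3 (fun (p : {poly R}) (m : nat) (x : R) =>
  (size p <= m.+1)%N /\ p`_m = x)) => [|i p m x _ [sp <-]].
  by rewrite size_poly1 coef1.
split; last by rewrite coefM_top.
apply: leq_trans (size_polyMleq _ _) _.
by rewrite -subn1 leq_subLR add1n -addnS -addSn leq_add.
Qed.

(** Each permutation takes one entry from every row, so the row bounds [d] add up. They need not be
    attained: the coefficient at their sum may be zero. *)
Lemma det_top (R : comNzRingType) (n : nat) (M : 'M[{poly R}]_n) (d : 'I_n -> nat) :
  (forall i j, (size (M i j) <= (d i).+1)%N) ->
  (size (\det M) <= (\sum_i d i).+1)%N /\
  (\det M)`_(\sum_i d i) = \det (\matrix_(i, j) (M i j)`_(d i)).
Proof.
move=> sM; have top (s : 'S_n) := prod_top (fun i => sM i (s i)).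
split.
  apply: leq_trans (size_sum _ _ _) _; apply/bigmax_leqP => s _.
  by rewrite -signr_odd; case: (odd _); rewrite ?mulN1r ?mul1r ?size_polyN; case: (top s).
rewrite /determinant coef_sum; apply: eq_bigr => s _.
rewrite -[in LHS]polyC1 -polyCN -polyC_exp coefCM; congr (_ * _).
by rewrite (top s).2; apply: eq_bigr => i _; rewrite mxE.
Qed.

(** In the equivalent pencil the first [r] rows have degree at most 1 and the others are constant.
    The row-wise top coefficients form a block triangular matrix with diagonal blocks 1 and
    [- drsubmx T]. *)
Lemma pencil_det_top (R : realType) (r k : nat) (E A M N : 'M[R]_(r + k)) :
  M *m E *m N = block_mx 1%:M 0 0 0 -> M \in unitmx -> N \in unitmx ->
  (size (pencil_det E A) <= r.+1)%N /\
  (pencil_det E A)`_r * (\det M * \det N) = \det (- drsubmx (M *m A *m N)).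
Proof.
move=> MEN uM uN; set T := M *m A *m N.
have detMN : \det M * \det N != 0.
  by rewrite mulf_neq0 // -unitfE -unitmxE.
pose L : 'M[{poly R}]_(r + k) :=
  'X *: map_mx polyC (block_mx 1%:M 0 0 0) - map_mx polyC T.
have detL : \det L = pencil_det E A * (\det M * \det N)%:P.
  rewrite polyCM /pencil_det mulrCA -!det_map_mx -!det_mulmx; congr (\det _).
  rewrite mulmxBl mulmxBr -scalemxAl -scalemxAr -!map_mxM !mulmxA.
  by rewrite MEN.
clearbody T.
pose d (i : 'I_(r + k)) : nat := (i < r)%N.
have sumd : (\sum_i d i = r)%N.
  rewrite big_split_ord /= (eq_bigr (fun _ => 1%N)) => [|i _]; last by rewrite /d /= ltn_ord.
  rewrite sum1_card card_ord big1 ?addn0 // => i _.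
  by rewrite /d /= ltnNge leq_addr.
have [|sL cL] := @det_top _ _ L d.
  move=> i j; rewrite !mxE /d; case: splitP => i' _; last first.
    by rewrite row_mx0 mxE polyC0 mulr0 add0r size_polyN size_polyC_leq1.
  apply: leq_trans (size_polyD _ _) _.
  rewrite geq_max size_polyN (leq_trans (size_polyC_leq1 _)) // andbT.
  apply: leq_trans (size_polyMleq _ _) _; rewrite size_polyX addSn /=.
  by rewrite -[2%N]/(1 + 1)%N leq_add // size_polyC_leq1.
rewrite sumd detL in sL cL; split.
  by move: sL; rewrite mulrC mul_polyC size_scale.
rewrite -coefMC cL.
have -> : (\matrix_(i, j) (L i j)`_(d i)) = block_mx 1%:M 0 (- dlsubmx T) (- drsubmx T).
  have LE i j : L i j = 'X * ((block_mx 1%:M 0 0 0 : 'M[R]_(r + k)) i j)%:P - (T i j)%:P.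
    by rewrite /L !mxE.
  apply/matrixP=> i j; rewrite mxE LE coefB coefXM !coefC /d.
  case: (split_ordP i) => i' ->; case: (split_ordP j) => j' ->; rewrite /= ?ltn_ord;
  rewrite ?(ltnNge (r + _)) ?leq_addr /= ?(block_mxEul, block_mxEur, block_mxEdl, block_mxEdr).
  - by rewrite subr0.
  - by rewrite subr0.
  - by rewrite sub0r !mxE.
  - by rewrite sub0r !mxE.
by rewrite det_lblock det1 mul1r.
Qed.

(** * Block form of the pencil *)

Lemma unitmx_row_kernel (F : fieldType) (n : nat) (M : 'M[F]_n) :
  (forall v : 'rV_n, v *m M = 0 -> v = 0) -> M \in unitmx.
Proof.
move=> kM; rewrite unitmxE unitfE; apply/negP => /det0P[v v0 vM].
by rewrite (kM v vM) eqxx in v0.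
Qed.

Lemma unitmx_col_kernel (F : fieldType) (n : nat) (M : 'M[F]_n) :
  (forall v : 'cV_n, M *m v = 0 -> v = 0) -> M \in unitmx.
Proof.
move=> kM; rewrite -unitmx_tr; apply: unitmx_row_kernel => v vM.
by apply: trmx_inj; rewrite trmx0; apply: kM; apply: trmx_inj;
  rewrite trmx_mul trmxK trmx0.
Qed.

(** [K] and [J] are one-sided inverses of the two factors of a full rank factorization of [E]. *)
Lemma rank_factor_inverse (F : fieldType) (n r : nat) (E : 'M[F]_n) :
  \rank E = r ->
  exists K : 'M[F]_(r, n), exists J : 'M[F]_(n, r), K *m E *m J = 1%:M.
Proof.
move=> <-; exists (pinvmx (col_base E)), (pinvmx (row_base E)).
have -> : pinvmx (col_base E) *m E = row_base E.
  apply: etrans (congr1 (mulmx _) (esym (mulmx_base E))) _.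
  by rewrite mulmxA mulVpmx ?col_base_full // mul1mx.
by rewrite mulmxVp ?row_base_free.
Qed.

Lemma row_free_full_rank (F : fieldType) (k n : nat) (E : 'M[F]_(k, n)) (v : 'rV_k) :
  \rank E = k -> v *m E = 0 -> v = 0.
Proof.
move=> rE vE; have fE : row_free E by rewrite /row_free rE.
by apply/eqP; rewrite -(mulmx_free_eq0 v fE) vE.
Qed.

Lemma col_full_rank_inj (F : fieldType) (k n : nat) (E : 'M[F]_(n, k)) (v : 'cV_k) :
  \rank E = k -> E *m v = 0 -> v = 0.
Proof.
move=> rE Ev; apply: trmx_inj; rewrite trmx0.
apply: (@row_free_full_rank _ _ _ E^T); first by rewrite mxrank_tr.
by rewrite -trmx_mul Ev trmx0.
Qed.

(** Multiplying a row relation x K + y E2 = 0 by [E *m J] kills the second term and leaves x = 0;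
    the rank of [E2] then gives y = 0. *)
Lemma col_mx_unit (F : fieldType) (r k : nat) (E : 'M[F]_(r + k))
    (E2 : 'M[F]_(k, r + k)) (K : 'M[F]_(r, r + k)) (J : 'M[F]_(r + k, r)) :
  \rank E2 = k -> E2 *m E = 0 -> K *m E *m J = 1%:M ->
  (col_mx K E2 : 'M_(r + k)) \in unitmx.
Proof.
move=> rE2 E2E KEJ; apply: unitmx_row_kernel => v.
rewrite -(hsubmxK v) mul_row_col => vM.
have x0 : lsubmx v = 0.
  have := congr1 (fun M => M *m E *m J) vM.
  rewrite mulmxDl -(mulmxA _ E2) E2E mulmx0 addr0 !mul0mx.
  by rewrite -!mulmxA (mulmxA K) KEJ mulmx1.
rewrite x0 mul0mx add0r in vM.
by rewrite x0 (row_free_full_rank rE2 vM) row_mx0.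
Qed.

Lemma row_mx_unit (F : fieldType) (r k : nat) (E : 'M[F]_(r + k))
    (E1 : 'M[F]_(r + k, k)) (K : 'M[F]_(r, r + k)) (J : 'M[F]_(r + k, r)) :
  \rank E1 = k -> E *m E1 = 0 -> K *m E *m J = 1%:M ->
  (row_mx J E1 : 'M_(r + k)) \in unitmx.
Proof.
move=> rE1 EE1 KEJ; rewrite -unitmx_tr tr_row_mx.
apply: (@col_mx_unit _ _ _ E^T _ _ K^T); first by rewrite mxrank_tr.
  by rewrite -trmx_mul EE1 trmx0.
by rewrite -!trmx_mul mulmxA KEJ trmx1.
Qed.

Lemma pencil_blocks (F : fieldType) (r k : nat) (E A : 'M[F]_(r + k))
    (E1 : 'M[F]_(r + k, k)) (E2 : 'M[F]_(k, r + k))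
    (K : 'M[F]_(r, r + k)) (J : 'M[F]_(r + k, r)) :
  E *m E1 = 0 -> E2 *m E = 0 -> K *m E *m J = 1%:M ->
  col_mx K E2 *m E *m row_mx J E1 = block_mx 1%:M 0 0 0 /\
  col_mx K E2 *m A *m row_mx J E1 =
    block_mx (K *m A *m J) (K *m A *m E1) (E2 *m A *m J) (E2 *m A *m E1).
Proof.
move=> EE1 E2E KEJ; split; rewrite mul_col_mx mul_col_row //.
by rewrite KEJ E2E !mul0mx -mulmxA EE1 mulmx0.
Qed.

(** The determinant has degree at most [r], so the two conditions together say that its coefficient
    at [r] is nonzero. *)
Lemma regular_impulse_freeP (R : realType) (r k : nat) (E A : 'M[R]_(r + k))
    (E1 : 'M[R]_(r + k, k)) (E2 : 'M[R]_(k, r + k)) :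
  \rank E = r -> \rank E1 = k -> E *m E1 = 0 -> \rank E2 = k -> E2 *m E = 0 ->
  regular E A /\ impulse_free E A <-> E2 *m A *m E1 \in unitmx.
Proof.
move=> rE rE1 EE1 rE2 E2E.
have [K [J KEJ]] := rank_factor_inverse rE.
have uM := col_mx_unit rE2 E2E KEJ; have uN := row_mx_unit rE1 EE1 KEJ.
have [MEN MAN] := pencil_blocks A EE1 E2E KEJ.
have [sp] := pencil_det_top A MEN uM uN; rewrite MAN block_mxKdr => cp.
have detMN : \det (col_mx K E2 : 'M_(r + k)) * \det (row_mx J E1) != 0.
  by rewrite mulf_neq0 // -unitfE -unitmxE.
have uE : (E2 *m A *m E1 \in unitmx) = ((pencil_det E A)`_r != 0).
  have := congr1 (fun x => x == 0) cp; rewrite /= mulf_eq0 (negbTE detMN) orbF => ->.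
  by rewrite -scaleN1r detZ mulf_eq0 expf_eq0 oppr_eq0 oner_eq0 andbF unitmxE unitfE.
rewrite uE /regular /impulse_free rE; move: (pencil_det E A) sp => q sp.
(* For the zero polynomial [(size q).-1] is 0, which would pass for the degree when [r] is 0;
   regularity excludes this. *)
split=> [[q0 <-]|qr]; first by rewrite -lead_coef_eq0 in q0.
have rs : (r < size q)%N by rewrite ltnNge; apply: contraNN qr => /leq_sizeP ->.
by rewrite -size_poly_gt0; have -> : size q = r.+1 by apply/eqP; rewrite eqn_leq sp.
Qed.

(** * Equivalence of admissibility and the LMI *)

Lemma admissible_of_lmi (R : realType) (alpha : R) (n r k : nat) (E A P : 'M[R]_n)
    (E1 : 'M[R]_(n, k)) (E2 : 'M[R]_(k, n)) (Q : 'M[R]_(n, k)) :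
  0 < alpha < 1 -> n = (r + k)%N -> \rank E = r ->
  \rank E1 = k -> E *m E1 = 0 -> \rank E2 = k -> E2 *m E = 0 ->
  Palpha alpha P -> negdef (symm (E^T *m P *m A + Q *m E2 *m A)) ->
  admissible alpha E A.
Proof.
move=> al en rE rE1 EE1 rE2 E2E hP hS; subst n.
suff uN : E2 *m A *m E1 \in unitmx.
  have [? ?] := (regular_impulse_freeP A rE rE1 EE1 rE2 E2E).2 uN.
  by split=> //; split=> //; apply: stable_of_lmi hS.
apply: unitmx_col_kernel => y Ny.
apply/eqP; apply: contraTT isT => y0.
have v0 : E1 *m y != 0 by apply: contraNneq y0 => /(col_full_rank_inj rE1) ->.
have : E2 *m (A *m (E1 *m y)) = 0 by rewrite !mulmxA.
have : E *m (E1 *m y) = 0 by rewrite mulmxA EE1 mul0mx.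
move: (E1 *m y) v0 => v v0 Ev E2Av.
(* Here [E *m v = 0] kills the term in [P] and [E2 *m A *m v = 0] the term in [Q]. *)
have W0 : v^T *m (E^T *m P *m A + Q *m E2 *m A) *m v = 0.
  rewrite mulmxDr mulmxDl -!mulmxA E2Av !mulmx0 addr0.
  by rewrite mulmxA -trmx_mul Ev trmx0 mul0mx.
have := hS.2 _ v0; rewrite /symm mulmxN mulNmx mulmxDr mulmxDl W0 addr0.
have := congr1 trmx W0; rewrite !trmx_mul trmxK trmx0 mulmxA => ->.
by rewrite oppr0 mxE ltxx.
Qed.

Lemma posdef1 (R : realType) (n : nat) : posdef (1%:M : 'M[R]_n).
Proof.
split=> [|v v0]; first by rewrite trmx1.
rewrite mulmx1 mxE lt0r sumr_ge0 ?andbT => [|i _]; last by rewrite mxE -expr2 sqr_ge0.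
apply: contraNN v0 => /eqP s0; apply/eqP/matrixP => i j; rewrite ord1 !mxE.
have /psumr_eq0P/(_ s0)/(_ i isT) : forall i, true -> 0 <= v^T ord0 i * v i ord0.
  by move=> i' _; rewrite mxE -expr2 sqr_ge0.
by rewrite mxE => /eqP; rewrite mulf_eq0 orbb => /eqP.
Qed.

Lemma posdef_congr (R : realType) (n : nat) (S H : 'M[R]_n) :
  S \in unitmx -> posdef H -> posdef (S^T *m H *m S).
Proof.
move=> uS /posdefE hH; apply/posdefE.
by have := hpd_congr (th := idfun) (fun _ => erefl) uS hH; rewrite /hadj map_mx_id.
Qed.

Lemma posdef_diag (R : realType) (m n : nat) (G : 'M[R]_m) (H : 'M[R]_n) :
  posdef G -> posdef H -> posdef (block_mx G 0 0 H).
Proof. by move=> /posdefE hG /posdefE hH; apply/posdefE/hpd_diag. Qed.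

Lemma posdef_ge0 (R : realType) (n : nat) (H : 'M[R]_n) (v : 'cV[R]_n) :
  posdef H -> 0 <= (v^T *m H *m v) ord0 ord0.
Proof.
move=> [_ pH]; have [->|/pH/ltW//] := eqVneq v 0.
by rewrite mulmx0 mxE.
Qed.

(* The complement [L] gets the identity, which is [X = 1], [Y = 0] up to the factor
   [sin (alpha * pi / 2)]. *)
Lemma Palpha_extend (R : realType) (alpha : R) (r k : nat) (P : 'M[R]_r)
    (K : 'M[R]_(r, r + k)) (L : 'M[R]_(k, r + k)) :
  (col_mx K L : 'M_(r + k)) \in unitmx -> Palpha alpha P ->
  Palpha alpha (K^T *m P *m K + sin (alpha * pi / 2) *: (L^T *m L)).
Proof.
move=> uM [X [Y [/posdef_skewP[XT YT pXY] ->]]].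
exists (K^T *m X *m K + L^T *m L), (K^T *m Y *m K); split; last first.
  rewrite mulmxDr mulmxDl -!scalemxAr -!scalemxAl scalerDr.
  by rewrite addrAC.
apply/posdef_skewP; split=> [||a b ab].
- by rewrite linearD /= !trmx_mul !trmxK XT mulmxA.
- by rewrite !trmx_mul trmxK YT mulNmx mulmxN mulmxA.
have -> : a^T *m (K^T *m X *m K + L^T *m L) *m a + b^T *m (K^T *m X *m K + L^T *m L) *m b
    + (a^T *m (K^T *m Y *m K) *m b) *+ 2
    = ((K *m a)^T *m X *m (K *m a) + (K *m b)^T *m X *m (K *m b)
       + ((K *m a)^T *m Y *m (K *m b)) *+ 2)
      + ((L *m a)^T *m 1%:M *m (L *m a) + (L *m b)^T *m 1%:M *m (L *m b)).
  rewrite !mulmx1 !trmx_mul !(mulmxDr, mulmxDl) !mulmxA.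
  by rewrite [RHS]addrAC; congr (_ + _); exact: addrACA.
have := posdef_ge0 (L *m a) (posdef1 R k); have := posdef_ge0 (L *m b) (posdef1 R k).
move=> Lb La; rewrite mxE [X in _ < _ + X]mxE.
(* Either the part in [K] is positive, or [K] kills both vectors and invertibility of the stacked
   matrix makes the part in [L] positive. *)
have [Kab|] := boolP ((K *m a != 0) || (K *m b != 0)).
  by rewrite ltr_wpDr ?addr_ge0 //; apply: pXY.
rewrite negb_or !negbK => /andP[/eqP Ka /eqP Kb].
rewrite Ka Kb !mulmx0 mul0rn !addr0 mxE add0r.
have inj (v : 'cV_(r + k)) : K *m v = 0 -> v != 0 -> L *m v != 0.
  move=> Kv; apply: contraNneq => Lv.
  by rewrite -(mulKmx uM v) mul_col_mx Kv Lv col_mx0 mulmx0.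
case/orP: ab => [/(inj _ Ka)|/(inj _ Kb)] /(posdef1 R k).2 => p0.
  by rewrite ltr_pwDl.
by rewrite ltr_wpDl.
Qed.

(** [P] and [Q] are chosen so that congruence by [T] turns the form into diag(P1 A1, - N^T N), where
    [P1] is a Lyapunov matrix of the finite block [A1]. *)
Lemma lmi_of_admissible (R : realType) (alpha : R) (n r k : nat) (E A : 'M[R]_n)
    (E1 : 'M[R]_(n, k)) (E2 : 'M[R]_(k, n)) :
  0 < alpha < 1 -> n = (r + k)%N -> \rank E = r ->
  \rank E1 = k -> E *m E1 = 0 -> \rank E2 = k -> E2 *m E = 0 ->
  admissible alpha E A ->
  exists P : 'M[R]_n, exists Q : 'M[R]_(n, k),
    Palpha alpha P /\ negdef (symm (E^T *m P *m A + Q *m E2 *m A)).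
Proof.
move=> al en rE rE1 EE1 rE2 E2E [reg [impf stab]]; subst n.
have uN : E2 *m A *m E1 \in unitmx.
  exact: (regular_impulse_freeP A rE rE1 EE1 rE2 E2E).1.
have [K0 [J0 KEJ0]] := rank_factor_inverse rE.
set N := E2 *m A *m E1 in uN.
(* [K] and [J] are corrected so that the blocks [K A E1] and [E2 A J] vanish. *)
pose K := K0 - K0 *m A *m E1 *m invmx N *m E2.
pose J := J0 - E1 *m invmx N *m E2 *m A *m J0.
have KEJ : K *m E *m J = 1%:M.
  rewrite /K mulmxBl -(mulmxA _ E2) E2E mulmx0 subr0 /J mulmxBr KEJ0.
  by rewrite -!mulmxA (mulmxA E) EE1 !(mul0mx, mulmx0) subr0.
have KAE1 : K *m A *m E1 = 0.
  rewrite /K !mulmxBl -!(mulmxA _ E2) -!(mulmxA _ _ E1) (mulmxA E2) -/N.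
  by rewrite mulmxKV ?subrr // mulmxA.
have E2AJ : E2 *m A *m J = 0.
  by rewrite /J mulmxBr !mulmxA -/N mulmxV // mul1mx subrr.
have uM := col_mx_unit rE2 E2E KEJ; have uT := row_mx_unit rE1 EE1 KEJ.
have [MET MAT] := pencil_blocks A EE1 E2E KEJ.
rewrite KAE1 E2AJ -/N in MAT; set A1 := K *m A *m J in MAT.
set M := col_mx K E2 in uM MET MAT; set T := row_mx J E1 in uT MET MAT.
(* The transformed pencil is block diagonal, so every eigenvalue of [A1] is a finite root of the
   original pencil. *)
have [lam detA1|P1 [hP1 [sP1 pP1]]] := @Palpha_lyapunov _ alpha r A1 al.
  apply: stab; set f := real_complex R.
  have fu (S : 'M[R]_(r + k)) : S \in unitmx -> \det (map_mx f S) != 0.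
    by rewrite det_map_mx fmorph_eq0 unitmxE unitfE.
  apply/eqP; move: (fu _ uM) (fu _ uT) => dM dT.
  have : \det (map_mx f M *m (lam *: map_mx f E - map_mx f A) *m map_mx f T) = 0.
    rewrite mulmxBr mulmxBl -scalemxAr -scalemxAl -!map_mxM MET MAT.
    rewrite !map_block_mx !map_mx0 map_mx1 scale_block_mx !scaler0 opp_block_mx.
    rewrite add_block_mx !oppr0 !addr0 det_lblock scalemx1.
    by rewrite detA1 mul0r.
  by rewrite !det_mulmx => /eqP; rewrite !mulf_eq0 (negbTE dM) (negbTE dT) orbF.
pose U := invmx T.
pose P := K^T *m P1 *m K + sin (alpha * pi / 2) *: (E2^T *m E2).
(* Since [dsubmx U *m T] is [row_mx 0 1%:M], this choice contributes exactly [- (N^T *m N)] in the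
   lower right block. *)
pose Q := - ((dsubmx U)^T *m N^T).
exists P, Q; split; first exact: Palpha_extend.
set W := E^T *m P *m A + _.
have UT : T^T *m (dsubmx U)^T = col_mx 0 1%:M.
  rewrite -trmx_mul; have -> : dsubmx U *m T = row_mx 0 1%:M.
    rewrite mul_dsub_mx /U mulVmx // scalar_mx_block.
    by rewrite /block_mx col_mxKd.
  by rewrite tr_row_mx trmx0 trmx1.
(* The added term [E2^T *m E2] in [P] is invisible on the range of [E]. *)
have EJP : (E *m J)^T *m P = P1 *m K.
  have KEJ' : (E *m J)^T *m K^T = 1%:M by rewrite -trmx_mul mulmxA KEJ trmx1.
  have EJE2 : (E *m J)^T *m E2^T = 0 by rewrite -trmx_mul mulmxA E2E mul0mx trmx0.
  by rewrite mulmxDr -scalemxAr !mulmxA KEJ' EJE2 mul0mx scaler0 addr0 mul1mx.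
have TWT : T^T *m W *m T = block_mx (P1 *m A1) 0 0 (- (N^T *m N)).
  have E2AT : E2 *m (A *m T) = row_mx 0 N by rewrite mul_mx_row mul_mx_row !mulmxA E2AJ.
  have KAT : K *m (A *m T) = row_mx A1 0 by rewrite mul_mx_row mul_mx_row !mulmxA KAE1.
  have TEP : T^T *m (E^T *m P) = col_mx (P1 *m K) 0.
    rewrite mulmxA -trmx_mul mul_mx_row EE1 tr_row_mx trmx0.
    by rewrite mul_col_mx EJP mul0mx.
  have TQ : T^T *m Q = col_mx 0 (- N^T).
    by rewrite /Q mulmxN mulmxA UT mul_col_mx mul0mx mul1mx opp_col_mx oppr0.
  rewrite /W mulmxDr mulmxDl !mulmxA -(mulmxA T^T) TEP TQ -!mulmxA E2AT.
  rewrite !mul_col_mx -mulmxA KAT !mul0mx !mul_mx_row !mulmx0 mulNmx.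
  by rewrite add_col_mx addr0 add0r /A1 /N !mulmxA.
rewrite /negdef; have -> : - symm W = U^T *m (block_mx (- symm (P1 *m A1)) 0 0 (2 *: (N^T *m N))) *m U.
  have -> : block_mx (- symm (P1 *m A1)) 0 0 (2 *: (N^T *m N)) = T^T *m - symm W *m T.
    rewrite /symm mulmxN mulNmx mulmxDr mulmxDl TWT.
    have -> : T^T *m W^T *m T = (T^T *m W *m T)^T by rewrite !trmx_mul trmxK mulmxA.
    rewrite TWT tr_block_mx !trmx0 add_block_mx opp_block_mx !addr0 !oppr0.
    congr block_mx => //; rewrite linearN /= (trmx_mul N^T) trmxK opprD opprK.
    by rewrite scaler_nat mulr2n.
  by rewrite !mulmxA -trmx_mul mulmxV // trmx1 mul1mx -mulmxA mulmxV // mulmx1.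
apply: posdef_congr; first by rewrite unitmx_inv.
apply: posdef_diag; first by split.
have -> : 2 *: (N^T *m N) = N^T *m 1%:M *m N + N^T *m 1%:M *m N.
  by rewrite mulmx1 scaler_nat mulr2n.
have h := posdef_congr uN (posdef1 R k).
by apply/posdefE/hpdD; apply/posdefE.
Qed.

Lemma symm_tr (R : realType) (n : nat) (M : 'M[R]_n) : symm M^T = symm M.
Proof. by rewrite /symm trmxK addrC. Qed.

Lemma admissible_tr (R : realType) (alpha : R) (n : nat) (E A : 'M[R]_n) :
  admissible alpha E A -> admissible alpha E^T A^T.
Proof.
have pE : pencil_det E^T A^T = pencil_det E A.
  by rewrite /pencil_det -!map_trmx -linearZ -linearB det_tr.
move=> [reg [impf stab]]; split; first by rewrite /regular pE.
split; first by rewrite /impulse_free pE impf mxrank_tr.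
by move=> lam; rewrite -!map_trmx -linearZ -linearB det_tr; apply: stab.
Qed.

(** The LMI of the transposed pencil, where [E2^T] and [E1^T] exchange roles, transposed back. *)
Lemma dual_lmi_of_admissible (R : realType) (alpha : R) (n r k : nat)
    (E A : 'M[R]_n) (E1 : 'M[R]_(n, k)) (E2 : 'M[R]_(k, n)) :
  0 < alpha < 1 -> n = (r + k)%N -> \rank E = r ->
  \rank E1 = k -> E *m E1 = 0 -> \rank E2 = k -> E2 *m E = 0 ->
  admissible alpha E A ->
  exists X : 'M[R]_n, exists Y : 'M[R]_(k, n),
    Palpha alpha X /\ negdef (symm (A *m X *m E^T + A *m E1 *m Y)).
Proof.
move=> al en rE rE1 EE1 rE2 E2E /admissible_tr adm.
have [|||||P [Q [hP hS]]] := @lmi_of_admissible _ _ n r k E^T A^T E2^T E1^T al en _ _ _ _ _ adm.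
- by rewrite mxrank_tr.
- by rewrite mxrank_tr.
- by rewrite -trmx_mul E2E trmx0.
- by rewrite mxrank_tr.
- by rewrite -trmx_mul EE1 trmx0.
exists P^T, Q^T; split; first exact: Palpha_tr.
move: hS; rewrite -symm_tr; congr (negdef (symm _)).
by rewrite linearD /= !trmx_mul !trmxK !mulmxA.
Qed.

(** * Feedback gain and the block LMI *)

(** The form vanishes on the kernel of [W]. This is what makes [K0] well defined. *)
Lemma negdef_symm_unit (R : realType) (n : nat) (A W : 'M[R]_n) :
  negdef (symm (A *m W)) -> W \in unitmx.
Proof.
move=> [_ pS]; apply: unitmx_col_kernel => v Wv.
apply/eqP; apply: contraTT isT => /pS.
rewrite /symm trmx_mul mulmxN mulNmx mulmxDr mulmxDl -!mulmxA Wv !mulmx0 addr0.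
by rewrite mulmxA -trmx_mul Wv trmx0 mul0mx oppr0 mxE ltxx.
Qed.

Lemma posdef_schur (R : realType) (m n : nat) (H : 'M[R]_n) (g : 'M[R]_(n, m))
    (N : 'M[R]_m) : posdef H -> posdef N ->
  posdef (block_mx H g g^T (N + g^T *m invmx H *m g)).
Proof.
move=> hH hN; have uH : H \in unitmx by apply: (hpd_unit (th := idfun)); apply/posdefE.
pose S : 'M[R]_(n + m) := block_mx 1%:M (invmx H *m g) 0 1%:M.
have uS : S \in unitmx by rewrite unitmxE det_ublock !det1 mulr1 unitr1.
have := posdef_congr uS (posdef_diag hH hN); congr posdef.
rewrite tr_block_mx !trmx1 trmx0 trmx_mul trmx_inv hH.1 !mulmx_block.
rewrite !(mulmx0, mul0mx, mulmx1, mul1mx, addr0, add0r).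
by rewrite mulmxKV // mulKVmx // mulmxA addrC.
Qed.

Lemma posdef_dr (R : realType) (m n : nat) (X : 'M[R]_m) (Y : 'M[R]_(m, n))
    (Z : 'M[R]_(n, m)) (T : 'M[R]_n) :
  posdef (block_mx X Y Z T) -> posdef T.
Proof.
move=> [hM pM]; split=> [|v v0].
  by move: hM; rewrite tr_block_mx => /eq_block_mx[].
have /pM : col_mx 0 v != 0 :> 'cV[R]_(m + n).
  by apply: contraNneq v0; rewrite -col_mx0 => /eq_col_mx[_ ->].
by rewrite tr_col_mx mul_row_block mul_row_col trmx0 !mul0mx !mulmx0 !add0r.
Qed.

(** The off-diagonal block is W B + S^T G^T, so the terms in [G] cancel. What remains is the
    symmetrization of W (A + B K) + W B S, and K + S = F C. *)
Lemma lmi_projection (R : realType) (n m p : nat) (W A : 'M[R]_n)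
    (B : 'M[R]_(n, m)) (C : 'M[R]_(p, n)) (F : 'M[R]_(m, p)) (K : 'M[R]_(m, n))
    (G : 'M[R]_m) :
  let V := W *m B + C^T *m (G *m F)^T - K^T *m G^T in
  let S := F *m C - K in
  (col_mx 1%:M S)^T *m block_mx (symm (W *m (A + B *m K))) V V^T (- G - G^T)
    *m col_mx 1%:M S = symm (W *m (A + B *m F *m C)).
Proof.
move=> V S.
have VE : V = W *m B + S^T *m G^T.
  by rewrite /V /S linearB /= mulmxBl !trmx_mul mulmxA addrA.
have -> : W *m (A + B *m F *m C) = W *m (A + B *m K) + W *m B *m S.
  by rewrite /S mulmxBr !mulmxDr !mulmxA -addrA [X in _ = _ + X]addrC subrK.
rewrite tr_col_mx trmx1 mul_row_block mul_row_col !mul1mx mulmx1 VE.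
move: S {V VE} (W *m B) (W *m (A + _)) => S U M.
have -> : (U + S^T *m G^T)^T = U^T + G *m S by rewrite linearD /= trmx_mul !trmxK.
have -> : U + S^T *m G^T + S^T *m (- G - G^T) = U - S^T *m G.
  by rewrite mulmxBr mulmxN addrA addrAC addrK.
rewrite mulmxDr mulmxBl mulmxA [LHS]addrA [LHS]addrAC addrA addrK.
by rewrite /symm linearD /= trmx_mul addrACA -addrA.
Qed.

Theorem theorem3 (R : realType) (alpha : R) (n r m p : nat)
  (E A : 'M[R]_n) (B : 'M[R]_(n, m)) (C : 'M[R]_(p, n))
  (E1 : 'M[R]_(n, n - r)) (E2 : 'M[R]_(n - r, n)) (F : 'M[R]_(m, p)) :
  0 < alpha < 1 ->
  (r < n)%N -> \rank E = r ->
  \rank E1 = (n - r)%N -> E *m E1 = 0 ->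
  \rank E2 = (n - r)%N -> E2 *m E = 0 ->
  admissible alpha E (A + B *m F *m C) <->
  (exists (X : 'M[R]_n) (Y : 'M[R]_(n - r, n)) (Z : 'M[R]_(m, n)),
     Palpha alpha X /\
     negdef (symm (A *m X *m E^T + A *m E1 *m Y + B *m Z)) /\
     (X *m E^T + E1 *m Y) \in unitmx /\
     let K0 := Z *m invmx (X *m E^T + E1 *m Y) in
     exists (P : 'M[R]_n) (Q : 'M[R]_(n, n - r)) (G : 'M[R]_m) (H : 'M[R]_(m, p)),
       Palpha alpha P /\
       G \in unitmx /\
       negdef (block_mx
                 (symm (E^T *m P *m (A + B *m K0) + Q *m E2 *m (A + B *m K0)))
                 ((E^T *m P + Q *m E2) *m B + C^T *m H^T - K0^T *m G^T)
                 ((E^T *m P + Q *m E2) *m B + C^T *m H^T - K0^T *m G^T)^T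
                 (- G - G^T)) /\
       F = invmx G *m H).
Proof.
move=> al rn rE rE1 EE1 rE2 E2E.
have en : n = (r + (n - r))%N by rewrite subnKC // ltnW.
split=> [adm|]; last first.
  move=> [X [Y [Z [_ [_ [_ [P [Q [G [H [hP [uG [hM FE]]]]]]]]]]]]].
  apply: (admissible_of_lmi al en rE rE1 EE1 rE2 E2E hP (Q := Q)).
  have HE : H = G *m F by rewrite FE mulKVmx.
  move: hM; rewrite -!mulmxDl HE; set K := Z *m _ => -[_ pM].
  split=> [|v v0]; first by rewrite linearN /= -/(symm _)^T /symm linearD /= trmxK addrC.
  rewrite -(lmi_projection _ _ _ _ _ K G) mulmxN mulNmx.
  (* The identity block makes the projection injective, so strict negativity is preserved. *)
  have /pM : col_mx 1%:M (F *m C - K) *m v != 0.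
    apply: contraNneq v0; rewrite mul_col_mx mul1mx -col_mx0 => /eq_col_mx[-> _].
    exact: eqxx.
  by rewrite trmx_mul mulmxN mulNmx !mulmxA.
have [X [Y [hX hS]]] := dual_lmi_of_admissible al en rE rE1 EE1 rE2 E2E adm.
have [P [Q [hP hT]]] := lmi_of_admissible al en rE rE1 EE1 rE2 E2E adm.
(* With this [Z] the gain [K0] becomes [F *m C] once [W] is known to be invertible. *)
pose W := X *m E^T + E1 *m Y; pose Z := F *m C *m W.
have AW : (A + B *m F *m C) *m X *m E^T + (A + B *m F *m C) *m E1 *m Y
    = (A + B *m F *m C) *m W by rewrite /W mulmxDr !mulmxA.
rewrite AW in hS; have uW := negdef_symm_unit hS.
exists X, Y, Z; split=> //; split.
  move: hS; congr (negdef (symm _)).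
  by rewrite -!(mulmxA A) -mulmxDr mulmxDl /Z !mulmxA.
split=> //; rewrite -/W /Z mulmxK //=.
pose V := (E^T *m P + Q *m E2) *m B.
set Phi := symm _ in hT.
(* [D] exceeds the Schur correction of [- Phi] by the identity. Being symmetric, it equals [G + G^T]
   for [G] its half. *)
pose D := 1%:M + V^T *m invmx (- Phi) *m V.
pose G := 2^-1 *: D.
have hB : posdef (block_mx (- Phi) (- V) (- V)^T D).
  have := posdef_schur (- V) hT (posdef1 R m).
  by rewrite linearN /= !mulNmx !mulmxN opprK.
have hD := posdef_dr hB.
have GG : G + G^T = D.
  by rewrite /G linearZ /= hD.1 -scalerDl (_ : _ + _ = 1) ?scale1r //; field.
have uG : G \in unitmx.
  rewrite /G unitmxZ ?unitfE ?invr_eq0 ?pnatr_eq0 //.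
  by apply: (hpd_unit (th := idfun)); apply/posdefE.
exists P, Q, G, (G *m F); split=> //; split=> //; split; last by rewrite mulKmx.
move: hB; rewrite /negdef; congr posdef.
rewrite -mulmxDl -opprD GG -/V.
(* With [H = G *m F] and [K0 = F *m C] the last two terms of the off-diagonal block cancel. *)
have -> : V + C^T *m (G *m F)^T - (F *m C)^T *m G^T = V.
  by rewrite !trmx_mul [C^T *m _]mulmxA addrK.
by rewrite [B *m _]mulmxA mulmxDl -/Phi opp_block_mx opprK [(- V)^T]linearN.
Qed.
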